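(* Let $X$ be a compact metric space and $f_{0,\infty}=\{f_n\}_{n=0}^\infty$ a sequence of continuous self-maps of $X$. Then $(X,f_{0,\infty})$ is multi-sensitive if and only if $(\mathcal{M}(X),\hat f_{0,\infty})$ is multi-sensitive.
   Context: Let $(X,d)$ be a compact metric space. A non-autonomous dynamical system $(X,f_{0,\infty})$ is given by a sequence $f_{0,\infty}=\{f_n\}_{n=0}^\infty$ of continuous self-maps of $X$; write $f_0^n=f_{n-1}\circ\cdots\circ f_0$ for $n\ge1$. $\mathcal{M}(X)$ is the space of all Borel probability measures on $X$ with the Prohorov metric $\mathcal{P}_d(\mu,\nu)=\inf\{\epsilon>0:\mu(A)\le\nu(A^\epsilon)+\epsilon \text{ and } \nu(A)\le\mu(A^\epsilon)+\epsilon \text{ for all Borel } A\subset X\}$, where $A^\epsilon=\{x\in X: d(x,A)<\epsilon\}$; its topology is the weak$^*$-topology and $\mathcal{M}(X)$ is a compact metric space. The induced system $(\mathcal{M}(X),\hat f_{0,\infty})$, $\hat f_{0,\infty}=\{\hat f_n\}_{n=0}^\infty$, consists of the continuous maps $\hat f_n(\mu)(A)=\mu(f_n^{-1}(A))$. For $x\in X$ and $\epsilon,\delta>0$ let $N_d(x,\epsilon,\delta)=\{n\ge1:\text{there exists } y \text{ with } d(x,y)<\epsilon \text{ and } d(f_0^n(x),f_0^n(y))>\delta\}$. $(X,f_{0,\infty})$ is multi-sensitive if there is $\delta>0$ such that $\bigcap_{i=1}^k N_d(x_i,\epsilon,\delta)\neq\emptyset$ for all $\epsilon>0$, $k\ge1$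 and $x_1,\dots,x_k\in X$. For $\mathcal{M}(X)$ the metric used is $\mathcal{P}_d$. *)

(* Defs.v *)
From HB Require Import structures.
From mathcomp Require Import all_boot all_order all_algebra.
From mathcomp Require Import all_classical all_reals all_analysis.

Set Implicit Arguments.
Unset Strict Implicit.
Unset Printing Implicit Defensive.

Import Order.TTheory GRing.Theory Num.Theory.
Local Open Scope classical_set_scope.
Local Open Scope ring_scope.

(* The point only records that the space is nonempty; the library requires it
   of every measurable space. *)
#[short(type="pmetricType")]
HB.structure Definition PointedMetric (K : numDomainType) :=
  {M of Metric K M & Pointed M}.

Section multi_sensitivity.
Context {R : realType} {T : Type}.
Implicit Types (d : T -> T -> R) (f : nat -> T -> T).

(* f_0^n = f_(n-1) \o ... \o f_0 *)
Fixpoint orbit_map f (n : nat) : T -> T :=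
  if n is m.+1 then f m \o orbit_map f m else id.

Definition separation_times d f (x : T) (eps delta : R) : set nat :=
  [set n | (1 <= n)%N /\
    exists y, d x y < eps /\ d (orbit_map f n x) (orbit_map f n y) > delta].

Definition multi_sensitive d f : Prop :=
  exists2 delta : R, 0 < delta &
    forall (eps : R) (k : nat) (x : 'I_k -> T), 0 < eps -> (1 <= k)%N ->
      \bigcap_(i in [set: 'I_k]) separation_times d f (x i) eps delta !=set0.

End multi_sensitivity.

Notation borel X := (g_sigma_algebraType (@open X)).

Definition borel_probability {R : realType} (X : pmetricType R) :=
  probability (borel X) R.

Section prohorov.
Context {R : realType} {X : pmetricType R}.

(* d(x, A); it is +oo when A is empty *)
Definition dist_to_set (x : X) (A : set X) : \bar R :=
  ereal_inf [set (mdist x a)%:E | a in A].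

Definition enlargement (A : set X) (eps : R) : set X :=
  [set x | (dist_to_set x A < eps%:E)%E].

Definition prohorov (mu nu : borel_probability X) : R :=
  inf [set eps : R | 0 < eps /\
    forall A : set (borel X), measurable A ->
      (mu A <= nu (enlargement A eps) + eps%:E)%E /\
      (nu A <= mu (enlargement A eps) + eps%:E)%E].

End prohorov.

Section induced_map.
Context {R : realType} {X : pmetricType R}.

Definition borel_map (f : continuousType X X) : borel X -> borel X := f.

Lemma borel_map_measurable (f : continuousType X X) :
  measurable_fun setT (borel_map f).
Proof.
apply: (@measurability _ _ (borel X) (borel X) _ _ (@open X)) => //.
move=> _ [B oB <-]; rewrite setTI; apply: sub_sigma_algebra.
by have /continuousP := @cts_fun _ _ f; exact.
Qed.

HB.instance Definition _ (f : continuousType X X) :=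
  isMeasurableFun.Build _ _ _ _ (borel_map f) (borel_map_measurable f).

Definition induced_map (f : continuousType X X) (mu : borel_probability X) :
  borel_probability X := distribution mu (borel_map f).

End induced_map.

(* Main.v *)
(* From X to M(X): round a measure mu to finitely many atoms p_j of a fine net
   by a measurable map q. At a common separation time n of the atoms, with
   witnesses y_j, some ball B of radius delta/4 from a fixed cover of X by N
   balls carries at least 1/N of the image of the rounded measure. Moving to y_j
   exactly those atoms whose image lies in the concentric ball of radius delta/2
   empties that ball, so the images of the rounded and of the perturbed measure
   are at distance at least about min(delta/8, 1/N); hence one of them is far
   from the image of mu. The bound depends on delta only, and one net serves all
   measures simultaneously.
   From M(X) to X: a measure close to the Dirac mass at x gives mass almost 1 to
   a small ball around x, so if that ball had small image under f_0^n, the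
   images of the two measures would be close too. *)
Require Import Defs.
From HB Require Import structures.
From mathcomp Require Import all_boot all_order all_algebra.
From mathcomp Require Import all_classical all_reals all_analysis.
From mathcomp Require Import finmap lra.

Set Implicit Arguments.
Unset Strict Implicit.
Unset Printing Implicit Defensive.

Import Order.TTheory GRing.Theory Num.Theory.
Local Open Scope classical_set_scope.
Local Open Scope ring_scope.

(** * Enlargements, and Borel measurability of balls and points *)

Section enlargement.
Context {R : realType} {X : pmetricType R}.
Implicit Types (A : set X) (x : X) (e : R).

Lemma enlargementP A e x :
  enlargement A e x <-> exists2 a, A a & mdist x a < e.
Proof.
split=> [/ereal_inf_lt[_ [a Aa <-]]|[a Aa xa]].
  by rewrite lte_fin; exists a.
apply: (@le_lt_trans _ _ (mdist x a)%:E); last by rewrite lte_fin.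
by apply: ereal_inf_lbound; exists a.
Qed.

Lemma enlargement_open A e : open (enlargement A e).
Proof.
rewrite openE => x /enlargementP[a Aa xa].
apply/nbhs_ballP; exists (e - mdist x a); first by rewrite /= subr_gt0.
move=> y; rewrite ballEmdist /= => xy; apply/enlargementP; exists a => //.
apply: (le_lt_trans (metric_triangle y x a)).
by rewrite (metric_sym y x) -ltrBrDr.
Qed.

Lemma measurable_enlargement A e : measurable (enlargement A e : set (borel X)).
Proof. by apply: sub_sigma_algebra; exact: enlargement_open. Qed.

Lemma enlargement_mono A e e' : e <= e' -> enlargement A e `<=` enlargement A e'.
Proof.
move=> ee' x /enlargementP[a Aa xa].
by apply/enlargementP; exists a => //; exact: lt_le_trans ee'.
Qed.

Lemma measurable_mball x e : measurable ([set y | mdist x y < e] : set (borel X)).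
Proof.
suff -> : [set y | mdist x y < e] = enlargement [set x] e.
  exact: measurable_enlargement.
apply/seteqP; split=> [y /= xy|y /enlargementP[_ /= -> ]].
  by apply/enlargementP; exists x => //; rewrite metric_sym.
by rewrite metric_sym.
Qed.

Lemma measurable_singleton x : measurable ([set x] : set (borel X)).
Proof.
rewrite -[X in measurable X]setCK; apply: measurableC; apply: sub_sigma_algebra.
apply: closed_openC; apply: accessible_closed_set1; apply: hausdorff_accessible.
exact: (@metric_hausdorff R X).
Qed.

End enlargement.

(** * Estimates for the Prohorov metric *)

Section prohorov_bounds.
Context {R : realType} {X : pmetricType R}.
Implicit Types (mu nu : borel_probability X) (e : R) (A : set (borel X)).

Lemma le_probability d (T : measurableType d) (P : probability T R)
    (A B : set T) :
  measurable A -> measurable B -> A `<=` B -> (P A <= P B)%E.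
Proof. by move=> mA mB AB; apply: le_measure => //; exact: mem_set. Qed.

Lemma prohorov_le mu nu e : 0 < e ->
  (forall A, measurable A ->
    (mu A <= nu (enlargement A e) + e%:E)%E /\
    (nu A <= mu (enlargement A e) + e%:E)%E) ->
  prohorov mu nu <= e.
Proof.
move=> e0 H; apply: ge_inf; last by split.
by exists 0 => r [/ltW].
Qed.

(** Enlargements grow with the radius, so an admissible [r < e] makes [e] itself admissible. *)
Lemma prohorov_lt mu nu e : prohorov mu nu < e ->
  forall A, measurable A ->
    (mu A <= nu (enlargement A e) + e%:E)%E /\
    (nu A <= mu (enlargement A e) + e%:E)%E.
Proof.
move=> /inf_lt[|r [r0 H] re A mA].
  (* The radius 1 is always admissible, so the infimum is over a nonempty set. *)
  exists 1; split=> // A mA; split; apply: (le_trans (probability_le1 _ mA));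
    by rewrite leeDr// measure_ge0.
have [H1 H2] := H A mA.
have mono (m : borel_probability X) :
    (m (enlargement A r) + r%:E <= m (enlargement A e) + e%:E)%E.
  apply: leeD; last by rewrite lee_fin ltW.
  apply: le_probability; try exact: measurable_enlargement.
  exact/enlargement_mono/ltW.
by split; [exact: le_trans (mono nu)|exact: le_trans (mono mu)].
Qed.

(** Points of [A] are sent by [g] into the enlargement of [A], and points sent into [A] lie in that
    enlargement; both inequalities follow by monotonicity of [mu]. *)
Lemma prohorov_distribution mu (g : {mfun borel X >-> borel X}) e : 0 < e ->
  (forall x, mdist (x : X) (g x) < e) -> prohorov mu (distribution mu g) <= e.
Proof.
move=> e0 H; apply: prohorov_le => // A mA.
have mE := @measurable_enlargement R X A e.
have le_addr (a : \bar R) : (a <= a + e%:E)%E by rewrite leeDl// lee_fin ltW.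
split; apply: le_trans (le_addr _).
- apply: (@le_probability _ _ mu _ (g @^-1` enlargement A e)) => //.
    exact: measurable_funPTI.
  by move=> x Ax; apply/enlargementP; exists x => //; rewrite metric_sym.
- apply: (@le_probability _ _ mu (g @^-1` A)) => //; first exact: measurable_funPTI.
  by move=> x Ax; apply/enlargementP; exists (g x).
Qed.

End prohorov_bounds.

(** By the union bound, [N] sets each of mass below [1/N] cannot cover the space. *)
Lemma probability_pigeonhole d (T : measurableType d) (R : realType)
    (P : probability T R) (N : nat) (F : nat -> set T) :
  (forall j, measurable (F j)) ->
  (forall x, exists2 j, (j < N)%N & F j x) ->
  exists j, (N%:R^-1%:E <= P (F j))%E.
Proof.
move=> mF cF; apply: contrapT => /forallNP small.
have N0 : (0 < N)%N by have [j + _] := cF point; exact: leq_ltn_trans.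
have : (1 <= \sum_(j < N) P (F j))%E.
  rewrite -(@probability_setT _ _ _ P).
  apply: le_trans (@Boole_inequality _ _ _ P F N (fun i _ => mF i)).
  apply: le_probability => //; first exact: bigsetU_measurable.
  by move=> x _; have [j jN Fx] := cF x; rewrite -bigcup_mkord; exists j.
apply/negP; rewrite -ltNge.
under eq_bigr do rewrite -(fineK (fin_num_measure P _ (mF _))).
have <- : \sum_(0 <= j < N) N%:R^-1 = 1 :> R.
  by rewrite sumr_const_nat subn0 -[_ *+ _]mulr_natr mulVf// pnatr_eq0 -lt0n.
rewrite sumEFin lte_fin -(big_mkord xpredT (fun j => fine (P (F j)))).
apply: ltr_sum_nat => // j _; rewrite -lte_fin fineK ?fin_num_measure//.
by rewrite ltNge; exact/negP/small.
Qed.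

(** * Finite nets and measurable rounding *)

Section finite_nets.
Context {R : realType} {X : pmetricType R}.

Lemma compact_net e : compact [set: X] -> 0 < e ->
  exists (N : nat) (p : nat -> X),
    forall x, exists2 j, (j < N)%N & mdist (p j) x < e.
Proof.
move=> cX e0; move: cX; rewrite compact_cover => /(_ X setT
  (fun c => enlargement [set c] e)).
case.
- by move=> c _; exact: enlargement_open.
- move=> x _; exists x => //; apply/enlargementP; exists x => //.
  by rewrite mdistxx.
move=> D _ cD; exists (size (enum_fset D)), (nth point (enum_fset D)) => x.
have [c /= cinD /enlargementP[_ /= -> xc]] := cD x I.
exists (index c (enum_fset D)); first by rewrite index_mem.
by rewrite nth_index// metric_sym.
Qed.

(** Choosing the least index of a net point within [e] makes [q] measurable: each nonempty fibre is
    a ball minus the balls of smaller index. *)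
Lemma measurable_net e : compact [set: X] -> 0 < e ->
  exists (N : nat) (p : nat -> X) (q : {mfun borel X >-> nat}),
    forall x, (q x < N)%N /\ mdist (p (q x)) x < e.
Proof.
move=> cX e0; have [N [p Np]] := compact_net cX e0.
pose near_center (x : X) := fun j => (j < N)%N && (mdist (p j) x < e).
have ex x : exists j, near_center x j.
  by have [j jN pj] := Np x; exists j; rewrite /near_center jN.
pose q (x : borel X) : nat := ex_minn (ex x).
have mq : measurable_fun setT q.
  move=> _ B _; rewrite setTI.
  pose F j := [set x : borel X | near_center x j].
  have mF j : measurable (F j).
    rewrite /F/near_center; case: (j < N)%N => /=; first exact: measurable_mball.
    by rewrite (_ : [set _ | _] = set0)//; apply/seteqP; split.
  suff -> : q @^-1` B = \bigcup_(j in B) seqDU F j.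
    by apply: bigcup_measurable => j _; exact: seqDU_measurable.
  apply/seteqP; split=> [x /= Bq|x [j Bj [/= Fj nF]]].
    exists (q x) => //; rewrite /seqDU /q; case: ex_minnP => j Fj minj.
    split=> //; rewrite -bigcup_mkord => -[i /= ij Fi].
    by have := minj _ Fi; rewrite leqNgt ij.
  suff -> : q x = j by [].
  rewrite /q; case: ex_minnP => i Fi mini; apply/eqP; rewrite eqn_leq mini//=.
  rewrite leqNgt; apply/negP => ij; apply: nF.
  by rewrite -bigcup_mkord; exists i.
pose Q := HB.pack_for {mfun borel X >-> nat} q (isMeasurableFun.Build _ _ _ _ q mq).
exists N, p, Q => x; rewrite /= /q.
by case: ex_minnP => j /andP[].
Qed.

(** Since [nat] carries the discrete sigma-algebra, [p] may be arbitrary; atoms can thus be moved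
    freely after rounding. *)
Lemma mfun_comp_nat (q : {mfun borel X >-> nat}) (p : nat -> X) :
  exists g : {mfun borel X >-> borel X}, forall x, g x = p (q x).
Proof.
pose g : borel X -> borel X := (p : nat -> borel X) \o q.
have mg : measurable_fun [set: borel X] g.
  by apply: measurableT_comp => // _ B _; rewrite setTI.
by exists (HB.pack_for {mfun borel X >-> borel X} g
  (isMeasurableFun.Build _ _ _ _ g mg)).
Qed.

End finite_nets.

(** * Iterates of the induced maps *)

Section orbits.
Context {R : realType} {X : pmetricType R} (f : nat -> continuousType X X).
Let G n := orbit_map (fun n => f n : X -> X) n.

(** The induction keeps [A] general: peeling off the last map replaces [A] by its preimage under
    [f n]. *)
Lemma orbit_induced_mapE n (mu : borel_probability X) (A : set (borel X)) :
  orbit_map (fun n => induced_map (f n)) n mu A = mu (G n @^-1` A).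
Proof. by elim: n A => // n IH A; exact: IH. Qed.

Lemma measurable_orbit_preimage n (A : set (borel X)) :
  measurable A -> measurable (G n @^-1` A : set (borel X)).
Proof.
elim: n A => // n IH A mA; apply: (IH (f n @^-1` A)).
exact: (measurable_funPTI (borel_map (f n))).
Qed.

End orbits.

(** * Transfer of multi-sensitivity in both directions *)

Section multi_sensitivity_transfer.
Context {R : realType} {X : pmetricType R}.
Context (cX : compact [set: X]) (f : nat -> continuousType X X).

Lemma multi_sensitive_induced :
  multi_sensitive (@mdist R X) (fun n => f n : X -> X) ->
  multi_sensitive (@prohorov R X) (fun n => induced_map (f n)).
Proof.
move=> [delta delta0 sens].
have [N [c Nc]] : exists (N : nat) (c : nat -> X),
    forall x, exists2 j, (j < N)%N & mdist (c j) x < delta / 4.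
  by apply: compact_net => //; rewrite divr_gt0.
have N0 : 0 < N%:R :> R.
  by rewrite ltr0n; have [j + _] := Nc point; exact: leq_ltn_trans.
have Ninv0 : 0 < N%:R^-1 :> R by rewrite invr_gt0.
(* The bound [delta / 8] keeps two enlargements by [e] of a [delta / 4] ball inside the [delta / 2]
   ball; the bound [N%:R^-1 / 4] makes [e + e] smaller than [1/N]. *)
pose e := Num.min (delta / 8) (N%:R^-1 / 4).
have e0 : 0 < e by rewrite lt_min !divr_gt0.
have [e_delta e_N] : e <= delta / 8 /\ e <= N%:R^-1 / 4.
  by rewrite !ge_min !lexx orbT.
(* Halving turns the negated separation, a bound by [e / 2], into the strict bound by [e] that
   [prohorov_lt] needs. *)
exists (e / 2); first by rewrite divr_gt0.
move=> eps k mu eps0 k0.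
have eps4 : 0 < eps / 4 by rewrite divr_gt0.
have [M [p [q Mp]]] := measurable_net cX eps4.
have M0 : (0 < M)%N by have [+ _] := Mp point; exact: leq_ltn_trans.
have [n nsens] := sens (eps / 4) M (fun j => p j) eps4 M0.
have n1 : (1 <= n)%N by have [] := nsens (Ordinal M0) I.
set G := orbit_map (fun n => f n : X -> X) n.
(* Indices outside the net get the default [point]. *)
have /choice[y yP] : forall j, exists y, (j < M)%N ->
    mdist (p j) y < eps / 4 /\ mdist (G (p j)) (G y) > delta.
  move=> j; have [jM|] := boolP (j < M)%N; last by exists point.
  by have [_ [y]] := nsens (Ordinal jM) I; exists y.
exists n => i _; split=> //; set m := mu i.
(* Rounding and moving an atom cost less than [eps / 4] each. *)
have close (h : nat -> X) (g : {mfun borel X >-> borel X}) :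
    (forall x, g x = h (q x)) ->
    (forall j, (j < M)%N -> mdist (p j) (h j) < eps / 4) ->
    prohorov m (distribution m g) < eps.
  move=> gE hp; apply: (@le_lt_trans _ _ (eps / 2)); last by lra.
  apply: prohorov_distribution => [|x]; first by rewrite divr_gt0.
  have [qM pq] := Mp x; rewrite gE.
  apply: (le_lt_trans (metric_triangle _ (p (q x)) _)).
  by have := hp _ qM; rewrite (metric_sym x); lra.
have [g gE] := mfun_comp_nat q p.
pose F j := [set z | mdist (c j) z < delta / 4].
have mF j : measurable (F j : set (borel X)) by exact: measurable_mball.
have [j0 mass] : exists j, (N%:R^-1%:E <= m ((G \o g) @^-1` F j))%E.
  apply: (@probability_pigeonhole _ _ _ m N (fun j => (G \o g) @^-1` F j)).
    move=> j; rewrite comp_preimage; apply: measurable_funPTI.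
    exact: measurable_orbit_preimage (mF j).
  by move=> x; exact: Nc.
pose h j := if mdist (c j0) (G (p j)) < delta / 2 then y j else p j.
have [g' g'E] := mfun_comp_nat q h.
apply: contrapT => /forallNP noy.
have far (g0 : {mfun borel X >-> borel X}) :
    prohorov m (distribution m g0) < eps ->
    prohorov (orbit_map (fun n => induced_map (f n)) n m)
      (orbit_map (fun n => induced_map (f n)) n (distribution m g0)) < e.
  move=> mg0; apply: (@le_lt_trans _ _ (e / 2)); last by lra.
  by rewrite leNgt; apply/negP => lt; exact: (noy (distribution m g0)).
(* Two Prohorov inequalities are chained through the image of [m]: from the rounded measure on
   [F j0] to [m] on its enlargement, then to the perturbed measure on the double enlargement [E]. *)
have /far/prohorov_lt/(_ _ (mF j0))[_] : prohorov m (distribution m g) < eps.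
  by apply: close gE _ => j _; rewrite mdistxx.
have /far/prohorov_lt/(_ _ (measurable_enlargement (F j0) e))[+ _] :
    prohorov m (distribution m g') < eps.
  apply: close g'E _ => j jM; rewrite /h; case: ifP => _; last by rewrite mdistxx.
  by have [] := yP j jM.
rewrite !orbit_induced_mapE -/G.
set E := enlargement (enlargement _ _) _.
have -> : (distribution m g' : borel_probability X) (G @^-1` E) = 0%E.
  change (m (g' @^-1` (G @^-1` E)) = 0%E).
  suff -> : g' @^-1` (G @^-1` E) = set0 by rewrite measure0.
  apply/seteqP; split=> // x /= /enlargementP[z /enlargementP[w cw zw]].
  rewrite /F /= in cw.
  rewrite g'E => hz; have [qM _] := Mp x; have [_ yfar] := yP _ qM.
  have := metric_triangle (c j0) w (G (h (q x))).
  have := metric_triangle w z (G (h (q x))).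
  rewrite (metric_sym w z) (metric_sym z (G _)) => wh ch.
  have {wh ch} : mdist (c j0) (G (h (q x))) < delta / 2.
    by move: cw zw hz wh ch e_delta; lra.
  (* An unmoved atom has its image outside the [delta / 2] ball; for a moved one, both images would
     lie in it, hence less than [delta] apart. *)
  rewrite /h; case: ifP => [cp cy|->//].
  have := metric_triangle (G (p (q x))) (c j0) (G (y (q x))).
  by rewrite (metric_sym _ (c j0)); move: cp cy yfar; lra.
rewrite add0e => mE mg.
have : (N%:R^-1%:E <= (e + e)%:E :> \bar R)%E.
  by rewrite EFinD; apply: le_trans mass (le_trans mg _); rewrite leeD2r.
by rewrite lee_fin; lra.
Qed.

Lemma multi_sensitive_of_induced :
  multi_sensitive (@prohorov R X) (fun n => induced_map (f n)) ->
  multi_sensitive (@mdist R X) (fun n => f n : X -> X).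
Proof.
move=> [delta delta0 sens]; exists (delta / 2); first by rewrite divr_gt0.
move=> eps k x eps0 k0.
(* The bound [eps] puts [V] inside the [eps]-ball around [x i]; the bound [delta] gives [V] mass at
   least [1 - delta]. *)
pose e := Num.min eps delta.
have e0 : 0 < e by rewrite lt_min eps0.
pose D i : borel_probability X := \d_(x i : borel X).
have DE i (A : set (borel X)) : D i A = (x i \in A)%:R%:E by exact: diracE.
have [n nsens] := sens e k D e0 k0.
exists n => i _; have [n1 [nu [xnu dist_delta]]] := nsens i I.
split=> //; set G := orbit_map (fun n => f n : X -> X) n.
apply: contrapT => /forallNP noy.
have {}noy y : mdist (x i) y < eps -> mdist (G (x i)) (G y) <= delta / 2.
  by move=> xy; rewrite leNgt; apply/negP => lt; exact: (noy y).
have oV := @enlargement_open R X [set x i] e.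
set V := enlargement [set x i] e in oV.
have mV : measurable (V : set (borel X)) by exact: measurable_enlargement.
have near y : V y -> mdist (G (x i)) (G y) < delta.
  move=> /enlargementP[_ /= -> yx].
  have /noy : mdist (x i) y < eps.
    by rewrite metric_sym (lt_le_trans yx)// ge_min lexx.
  by move=> /le_lt_trans; apply; lra.
have nuV : (1 <= nu V + delta%:E)%E.
  have [+ _] := prohorov_lt xnu (measurable_singleton (x i)).
  rewrite DE mem_set// => /le_trans; apply; apply: leeD => //.
  by rewrite lee_fin ge_min lexx orbT.
apply/negP: dist_delta; rewrite -leNgt; apply: prohorov_le => // A mA.
rewrite !orbit_induced_mapE -/G !DE.
have mE := measurable_enlargement A delta.
have mGA := measurable_orbit_preimage f n mA.
have mGE := measurable_orbit_preimage f n mE.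
split.
(* If [G (x i)] lies in [A], then [G] maps all of [V] into the [delta]-enlargement of [A]. *)
- case: (boolP (x i \in _)) => [|_]; last by rewrite adde_ge0// lee_fin ltW.
  move=> /set_mem Ax; apply: (le_trans nuV); rewrite leeD2r//.
  apply: le_probability => // y Vy; apply/enlargementP.
  by exists (G (x i)) => //; rewrite metric_sym; exact: near.
- case: (boolP (x i \in _)) => [_|/negP Ex].
    by apply: (le_trans (probability_le1 _ mGA)); rewrite leeDl// lee_fin ltW.
  (* Here [G (x i)] is outside the enlargement, so the preimage of [A] misses [V] and has mass at
     most [delta]. *)
  rewrite add0e; apply: (@le_trans _ _ (nu (~` V))).
    apply: le_probability => //; first exact: measurableC.
    move=> y Ay Vy; apply: Ex; apply/mem_set/enlargementP.
    by exists (G y) => //; exact: near.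
  by rewrite probability_setC// leeBlDr ?fin_num_measure// addeC.
Qed.

End multi_sensitivity_transfer.

Theorem theorem4p4 (R : realType) (X : pmetricType R)
    (cX : compact [set: X]) (f : nat -> continuousType X X) :
  multi_sensitive (@mdist R X) (fun n => f n : X -> X) <->
  multi_sensitive (@prohorov R X) (fun n => induced_map (f n)).
Proof.
split; first exact: multi_sensitive_induced.
exact: multi_sensitive_of_induced.
Qed.
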